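(* Let $M$ be a sparse paving matroid of rank $r$, let $k\geq 2$ be an integer, and let $S$ be a multiset of size $kr$ whose elements lie in $E(M)$. Then the graph $G_M(S)$ is connected.
   Context: A matroid $M$ of rank $r$ is sparse paving if every nonspanning circuit of $M$ is a hyperplane; equivalently, every $r$-element subset of $E(M)$ is either a basis or a circuit-hyperplane. The graph $G_M(S)$ is defined as follows: its vertices are all multisets $\{A_1,\dots,A_k\}$ of $k$ bases of $M$ whose multiset union is $S$; vertices $\mathcal{A}$ and $\mathcal{B}=\{B_1,\dots,B_k\}$ are adjacent if, for some two bases $B_i,B_j$ in $\mathcal{B}$ and elements $b_i\in B_i-B_j$, $b_j\in B_j-B_i$, the multiset $\mathcal{A}$ is obtained from $\mathcal{B}$ by replacing $B_i$ by $(B_i-b_i)\cup\{b_j\}$ and $B_j$ by $(B_j-b_j)\cup\{b_i\}$ (a symmetric exchange). The graph may be empty (an empty graph is regarded as connected). *)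

(* Defs.v *)
From Stdlib Require Import Relations.
From mathcomp Require Import all_boot.
Set Implicit Arguments. Unset Strict Implicit. Unset Printing Implicit Defensive.

Section Matroid.
Variable E : finType.
Implicit Types (BB : {set {set E}}) (X I C F H : {set E}).

Definition is_matroid_bases BB : Prop :=
  BB != set0 /\
  forall B1 B2, B1 \in BB -> B2 \in BB -> forall x, x \in B1 :\: B2 ->
    exists2 y, y \in B2 :\: B1 & (y |: (B1 :\ x)) \in BB.

Definition indep BB I : bool := [exists B in BB, I \subset B].

Definition mrank BB X : nat := \max_(I in powerset X | indep BB I) #|I|.

Definition matroid_rank BB : nat := mrank BB setT.

Definition circuit BB C : Prop :=
  ~~ indep BB C /\ forall D : {set E}, D \proper C -> indep BB D.

Definition flat BB F : Prop :=
  forall e : E, e \notin F -> mrank BB F < mrank BB (e |: F).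

Definition hyperplane BB H : Prop :=
  flat BB H /\ mrank BB H = (matroid_rank BB).-1.

Definition sparse_paving BB : Prop :=
  forall C, circuit BB C -> mrank BB C < matroid_rank BB -> hyperplane BB C.

(* The graph G_M(S).  A multiset {A_1,...,A_k} of bases is represented by a
   list (up to permutation, perm_eq); a multiset S of elements of E by its
   multiplicity function. *)
Definition GM_vertex BB (k : nat) (S : {ffun E -> nat}) (L : seq {set E}) : Prop :=
  size L = k /\ all (fun A => A \in BB) L /\
  forall e : E, count (fun A : {set E} => e \in A) L = S e.

Definition sym_exchange (L L' : seq {set E}) : Prop :=
  exists i j : nat, [/\ i < size L, j < size L & i != j] /\
  exists bi bj,
    [/\ bi \in nth set0 L i :\: nth set0 L j,
        bj \in nth set0 L j :\: nth set0 L i &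
        perm_eq L'
          (set_nth set0 (set_nth set0 L i (bj |: (nth set0 L i :\ bi)))
                   j (bi |: (nth set0 L j :\ bj)))].

(* adjacency in G_M(S) on representatives; perm_eq lists are the same vertex *)
Definition GM_adj BB k S (L L' : seq {set E}) : Prop :=
  GM_vertex BB k S L /\ GM_vertex BB k S L' /\
  (perm_eq L L' \/ sym_exchange L L' \/ sym_exchange L' L).

Definition GM_connected BB k S : Prop :=
  forall L L', GM_vertex BB k S L -> GM_vertex BB k S L' ->
    clos_refl_sym_trans _ (GM_adj BB k S) L L'.

End Matroid.

(* Main.v *)
(** Call two r-sets adjacent if each is obtained from the other by replacing one
    element. In a sparse paving matroid no two nonbases of size [r] are
    adjacent, so every neighbour of a nonbasis is a basis; the argument uses
    nothing else.

    Let [A] and [B] be members of two vertices with the same multiset union. It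
    is enough to move [A] closer to [B]: once [A = B], induct on [k]. Comparing
    multiplicities on [A - B] and [B - A], up to exchanging the two vertices
    there is another member [D] of the vertex of [A] that contains more elements
    of [B - A] than of [A - B]. If [|A - B| > 1], some two elements of
    [(A - B) - D] or of [D /\ (B - A)] are available, and one or two exchanges
    between [A] and [D] decrease [|A - B|]. If [A - B = {a}] and [B - A = {b}],
    the exchange fails only if [N = D - b + a] is a nonbasis. Counting elements
    outside [N], some other member [G] has [|G - N| > 1], as otherwise [N] would
    be a member of the vertex of [B]. An exchange of [f] in [D] with [g] in [G]
    turns [N] into its neighbour [N - f + g], a basis, and unblocks the exchange
    of [a] and [b]. *)

From Stdlib Require Import Relations.
Require Import Defs.
From mathcomp Require Import all_boot zify.
Set Implicit Arguments. Unset Strict Implicit. Unset Printing Implicit Defensive.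

(** * Adjacency of sets of equal size, and tactics for membership goals *)

Definition swap (E : finType) (X : {set E}) (x y : E) : {set E} := y |: (X :\ x).

(** For sets of size [r], the inclusion [Y \subset z |: X] with [z] entering says that [Y] arises
    from [X] by replacing one element by [z]. The leaving element stays unnamed, so the side
    conditions are plain membership facts. *)
Definition scattered (E : finType) (BB : {set {set E}}) (r : nat) : Prop :=
  (forall B, B \in BB -> #|B| = r) /\
  forall (X Y : {set E}) z, #|X| = r -> X \notin BB -> #|Y| = r ->
    z \in Y -> z \notin X -> Y \subset z |: X -> Y \in BB.

Ltac set_cases :=
  rewrite ?inE;
  repeat match goal with
  | H : is_true (?x \in ?A), H' : is_true (?x \notin ?A) |- _ =>
      by rewrite H in H'
  | H : is_true (?x != ?x) |- _ => by rewrite eqxx in H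
  | |- context [?x == ?x] => rewrite (eqxx x)
  | H : is_true (?x \in ?A) |- context [?x \in ?A] => rewrite H
  | H : is_true (?x \notin ?A) |- context [?x \in ?A] => rewrite (negPf H)
  | H : is_true (?x != ?y) |- context [?x == ?y] => rewrite (negPf H)
  | H : is_true (?y != ?x) |- context [?x == ?y] =>
      rewrite (eq_sym x y) (negPf H)
  | |- context [?x == ?y] => have [?|?] := eqVneq x y; [subst|]
  end; rewrite ?(andbT, andbF, orbT, orbF) //=.

Ltac set_solve :=
  rewrite /swap; set_cases;
  repeat match goal with |- context [?x \in ?A] => case: (x \in A) end;
  rewrite //=.

(** * Cardinalities, pigeonhole and double counting *)

Section Sets.
Context {E : finType}.
Implicit Types (X Y A B D : {set E}) (BB : {set {set E}}).

Lemma card_swap X x y : x \in X -> y \notin X -> #|swap X x y| = #|X|.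
Proof.
move=> xX yX; rewrite /swap cardsU1 !inE (negPf yX) andbF (cardsD1 x X) xX.
by rewrite add1n.
Qed.

Lemma card_setDC X Y : #|X| = #|Y| -> #|X :\: Y| = #|Y :\: X|.
Proof. by move=> e; have := cardsID Y X; have := cardsID X Y; rewrite setIC; lia. Qed.

Lemma card_ge2 X : 2 <= #|X| -> exists x y, [/\ x \in X, y \in X & x != y].
Proof. by move=> /card_gt1P [x [y []]]; exists x, y. Qed.

(** Each predicate excludes at most one element of [X], so among three elements one survives. *)
Lemma exists_avoiding2 X (bad1 bad2 : pred E) :
  {in X &, forall x y, bad1 x -> bad1 y -> x = y} ->
  {in X &, forall x y, bad2 x -> bad2 y -> x = y} ->
  3 <= #|X| -> exists x, [/\ x \in X, ~~ bad1 x & ~~ bad2 x].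
Proof.
move=> u1 u2 X3.
have le1 (bad : pred E) : {in X &, forall x y, bad x -> bad y -> x = y} ->
    #|[set x in X | bad x]| <= 1.
  move=> u; apply/card_le1_eqP => x y; rewrite !inE.
  by move=> /andP [xX bx] /andP [yX by_]; apply: u.
have [/existsP [x /and3P [xX n1 n2]]|] :=
  boolP [exists x, [&& x \in X, ~~ bad1 x & ~~ bad2 x]]; first by exists x.
rewrite negb_exists => /forallP all_bad.
have sub : X \subset [set x in X | bad1 x] :|: [set x in X | bad2 x].
  apply/subsetP => x xX; have := all_bad x; rewrite !inE xX /=.
  by case: (bad1 x); case: (bad2 x).
have := subset_leq_card sub; have := le1 _ u1; have := le1 _ u2.
have := cardsUI [set x in X | bad1 x] [set x in X | bad2 x]; lia.
Qed.

Lemma exists_avoiding X (bad : pred E) :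
  {in X &, forall x y, bad x -> bad y -> x = y} ->
  2 <= #|X| -> exists2 x, x \in X & ~~ bad x.
Proof.
move=> u /card_ge2 [x [y [xX yX xy]]].
have [bx|nx] := boolP (bad x); last by exists x.
have [by_|ny] := boolP (bad y); last by exists y.
by case/eqP: xy; apply: u.
Qed.

(** Double counting of incidences: the sum depends only on the multiset union of [L], so it agrees
    on any two vertices of the same graph. *)
Lemma sum_card_setI (L : seq {set E}) (Z : {set E}) :
  \sum_(X <- L) #|X :&: Z| = \sum_(e in Z) count (fun X : {set E} => e \in X) L.
Proof.
elim: L => [|X L IH]; first by rewrite big_nil big1.
rewrite big_cons IH /= big_split /=; congr (_ + _).
by rewrite -sum1_card big_mkcond [RHS]big_mkcond; apply: eq_bigr => e _;
  rewrite inE; case: (e \in X); case: (e \in Z).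
Qed.

End Sets.

Ltac swap_card H :=
  rewrite ?card_swap ?(proj1 H) //; set_solve.

(** Shows that a set is a basis as a neighbour of the nonbasis given by [nX]; [z] is its element
    outside that nonbasis. *)
Ltac adjacent H nX z :=
  apply: (proj2 H _ _ z _ nX);
  [ swap_card H | swap_card H | set_solve | set_solve
  | let e := fresh "e" in apply/subsetP => e; set_solve ].

(** * Chains of symmetric exchanges on lists of bases *)

Section Link.
Context {E : finType}.
Variable BB : {set {set E}}.
Implicit Types (X Y A B D : {set E}) (L T : seq {set E}).

(** Exchanges act on the first two entries only, since permutations bring any pair to the front.
    Leaving out [k] and [S] allows a common member to be prepended to a whole chain. *)
Definition link_step L L' : Prop :=
  [/\ all (fun X => X \in BB) L, all (fun X => X \in BB) L' &
   perm_eq L L' \/ exists X Y T x y,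
    [/\ L = [:: X, Y & T], L' = [:: swap X x y, swap Y y x & T],
        x \in X :\: Y & y \in Y :\: X]].

Definition linked := clos_refl_sym_trans _ link_step.

Lemma linked_trans L1 L2 L3 : linked L1 L2 -> linked L2 L3 -> linked L1 L3.
Proof. exact: rst_trans. Qed.

Lemma linked_sym L1 L2 : linked L1 L2 -> linked L2 L1.
Proof. exact: rst_sym. Qed.

Lemma linked_perm L L' :
  all (fun X => X \in BB) L -> perm_eq L L' -> linked L L'.
Proof.
move=> bL p; apply: rst_step; split=> //; last by left.
by rewrite -(perm_all _ p).
Qed.

(** As exchanges happen at the front, [X] is rotated behind the exchanged pair and back again. *)
Lemma linked_cons X L L' : X \in BB -> linked L L' -> linked (X :: L) (X :: L').
Proof.
move=> bX; elim=> [{}L {}L' [bL bL' []]|L1|L1 L2 _ IH|L1 L2 L3 _ IH1 _ IH2].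
- by move=> p; apply: linked_perm; rewrite /= ?bX // perm_cons.
- move=> [Y [Z [T [y [z [eL eL' yY zZ]]]]]]; subst L L'.
  have bT : all (fun X => X \in BB) T by case/and3P: bL.
  have rot3 (U V W : {set E}) R : perm_eq [:: U, V, W & R] [:: V, W, U & R].
    by apply/permP => p /=; lia.
  apply: (@linked_trans _ [:: Y, Z, X & T]).
    by apply: linked_perm; rewrite /= ?bX.
  apply: (@linked_trans _ [:: swap Y y z, swap Z z y, X & T]).
    apply: rst_step; split.
    + by move: bL; rewrite /= bX => /and3P [-> -> ->].
    + by move: bL'; rewrite /= bX => /and3P [-> -> ->].
    + by right; exists Y, Z, (X :: T), y, z.
  by apply: linked_sym; apply: linked_perm; rewrite /= ?bX.
- exact: rst_refl.
- exact: linked_sym.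
- exact: linked_trans IH1 IH2.
Qed.

Lemma linked_swap X Y T x y :
  X \in BB -> Y \in BB -> all (fun X => X \in BB) T ->
  x \in X -> x \notin Y -> y \in Y -> y \notin X ->
  swap X x y \in BB -> swap Y y x \in BB ->
  linked [:: X, Y & T] [:: swap X x y, swap Y y x & T].
Proof.
move=> bX bY bT xX xY yY yX bX' bY'; apply: rst_step.
split; rewrite /= ?bX ?bY ?bX' ?bY' //.
by right; exists X, Y, T, x, y; rewrite !inE xX xY yX.
Qed.

(** An exchange preserves length and multiplicities. The equivalence is proved along with the path
    because transitivity needs the intermediate list to be a vertex. *)
Lemma linked_GM L L' k S :
  linked L L' -> (GM_vertex BB k S L <-> GM_vertex BB k S L') /\
    (GM_vertex BB k S L -> clos_refl_sym_trans _ (GM_adj BB k S) L L').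
Proof.
elim=> [{}L {}L' [bL bL' st]|L1|L1 L2 _ [e c]|L1 L2 L3 _ [e1 c1] _ [e2 c2]].
- have e : GM_vertex BB k S L <-> GM_vertex BB k S L'.
    rewrite /GM_vertex bL bL'.
    suff [-> ec] : size L = size L' /\
        forall e, count (fun A : {set E} => e \in A) L
                  = count (fun A : {set E} => e \in A) L'.
      by split=> -[? [_ h]]; split=> //; split=> // e; rewrite ?ec // -ec.
    case: st => [p|[X [Y [T [x [y [-> -> ]]]]]]].
      by split; [exact: perm_size|move=> e; apply/permP].
    rewrite !inE => /andP [xY xX] /andP [yX yY]; split=> //= e; rewrite !addnA.
    by congr (_ + _); rewrite /swap; set_cases; lia.
  split=> // vL; apply: rst_step; split=> //; split; first exact/e.
  case: st => [p|[X [Y [T [x [y [eL eL' xX yY]]]]]]]; first by left.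
  right; left; subst L L'; exists 0, 1; split=> //.
  by exists x, y.
- by split=> // _; apply: rst_refl.
- by split; [split=> /e|move=> /e /c; apply: rst_sym].
- split; first by split=> [/e1/e2|/e2/e1].
  by move=> v; apply: rst_trans (c1 v) _; apply: c2; apply/e1.
Qed.

End Link.

(** * From sparse paving matroids to scattered nonbases *)

Section SparsePaving.
Context {E : finType}.
Implicit Types (X Y I A B C : {set E}) (BB : {set {set E}}).

(** Exchanges move [B1] towards [B2] at constant cardinality until it is contained in [B2]. *)
Lemma bases_card_le BB B1 B2 :
  is_matroid_bases BB -> B1 \in BB -> B2 \in BB -> #|B1| <= #|B2|.
Proof.
move=> [_ exch]; have [n] := ubnP #|B1 :\: B2|.
elim: n B1 => // n IH B1 lt_n bB1 bB2.
have [e|[x xD]] := set_0Vmem (B1 :\: B2).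
  by apply: subset_leq_card; rewrite -setD_eq0 e.
have [y yD bB] := exch _ _ bB1 bB2 x xD.
move: (xD) (yD); rewrite !inE => /andP [xB2 xB1] /andP [yB1 yB2].
rewrite -(card_swap xB1 yB1); apply: IH => //.
have lt : swap B1 x y :\: B2 \proper B1 :\: B2.
  apply/properP; split; last by exists x => //; rewrite /swap; set_cases.
  by apply/subsetP => e; rewrite /swap; set_cases; case: (e \in B1); rewrite ?andbF ?andbT.
have := proper_card lt; lia.
Qed.

Lemma bases_card BB B :
  is_matroid_bases BB -> B \in BB -> #|B| = matroid_rank BB.
Proof.
move=> mBB bB; apply/eqP; rewrite eqn_leq; apply/andP; split.
  apply: (leq_bigmax_cond (P := fun I => (I \in powerset setT) && indep BB I)).
  by rewrite powersetE subsetT; apply/existsP; exists B; rewrite bB subxx.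
apply/bigmax_leqP => I /andP [_ /existsP [B' /andP [bB' sI]]].
exact: leq_trans (subset_leq_card sI) (bases_card_le mBB bB' bB).
Qed.

Lemma indep_card BB I :
  is_matroid_bases BB -> indep BB I -> #|I| = matroid_rank BB -> I \in BB.
Proof.
move=> mBB /existsP [B /andP [bB sIB]] cI.
suff -> : I = B by [].
by apply/eqP; rewrite eqEcard sIB cI (bases_card mBB bB) leqnn.
Qed.

Lemma dependent_circuit BB X :
  ~~ indep BB X -> exists2 C, circuit BB C & C \subset X.
Proof.
move=> dX; have [C /minsetP [dC minC] sC] :=
  minset_exists (P := fun Y => ~~ indep BB Y) dX.
exists C => //; split=> // D pD; apply: contraT => dD.
by have := pD; rewrite (minC D dD (proper_sub pD)) properxx.
Qed.

Lemma mrank_mono BB X Y : X \subset Y -> mrank BB X <= mrank BB Y.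
Proof.
move=> sXY; apply/bigmax_leqP => I /andP []; rewrite powersetE => sI iI.
apply: (leq_bigmax_cond (P := fun I => (I \in powerset Y) && indep BB I)).
by rewrite powersetE (subset_trans sI sXY).
Qed.

Lemma mrank_indep BB X : is_matroid_bases BB ->
  exists2 I : {set E}, I \subset X & indep BB I /\ #|I| = mrank BB X.
Proof.
move=> [/set0Pn [B bB] _].
pose P : pred {set E} := [pred I : {set E} | (I \in powerset X) && indep BB I].
have P0 : 0 < #|P|.
  apply/card_gt0P; exists set0; rewrite inE powersetE sub0set /=.
  by apply/existsP; exists B; rewrite bB sub0set.
have [I /andP [sI iI] e] := eq_bigmax_cond (fun I : {set E} => #|I|) P0.
by exists I; [rewrite -powersetE|split=> //; rewrite -e].
Qed.

(** A circuit [C] inside [X] is nonspanning, hence a hyperplane of rank one below the full rank.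
    Being dependent, [C] is larger than its rank, so it fills [X]. *)
Lemma nonbasis_circuit_hyperplane BB X :
  is_matroid_bases BB -> sparse_paving BB ->
  #|X| = matroid_rank BB -> X \notin BB -> circuit BB X /\ hyperplane BB X.
Proof.
move=> mBB sp cX nX.
have dX : ~~ indep BB X by apply: contra nX => iX; apply: indep_card.
have rX : mrank BB X < matroid_rank BB.
  have [I sI [iI <-]] := mrank_indep X mBB.
  rewrite ltn_neqAle; apply/andP; split.
    apply: contra dX => /eqP cI; suff <- : I = X by [].
    by apply/eqP; rewrite eqEcard sI cX cI leqnn.
  by rewrite -cX subset_leq_card.
have [C cC sC] := dependent_circuit dX.
have hC : hyperplane BB C by apply: sp => //; exact: leq_ltn_trans (mrank_mono _ sC) rX.
suff eCX : C = X by rewrite -eCX.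
apply/eqP; rewrite eqEcard sC cX /=.
have [I sI [iI cI]] := mrank_indep C mBB.
have pI : I \proper C.
  rewrite properE sI; apply: contra (proj1 cC) => sCI.
  by rewrite (_ : C = I) //; apply/eqP; rewrite eqEsubset sI sCI.
have := proper_card pI; rewrite cI (proj2 hC); lia.
Qed.

(** If [X] and [Y] were adjacent nonbases, [z |: X] would be spanning because [X] is flat, and
    [J = Y - z] independent because [Y] is a circuit. Extending [J] to a basis inside [z |: X] can
    only give [X] or [Y]. *)
Lemma sparse_paving_scattered BB :
  is_matroid_bases BB -> sparse_paving BB -> scattered BB (matroid_rank BB).
Proof.
move=> mBB sp; split=> [B|X Y z cX nX cY zY zX sY]; first exact: bases_card.
apply: contraT => nY.
have [[dX _] [flX rX]] := nonbasis_circuit_hyperplane mBB sp cX nX.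
have [[dY indY] _] := nonbasis_circuit_hyperplane mBB sp cY nY.
have [B sB [iB cB]] := mrank_indep (z |: X) mBB.
(* Flatness pushes the rank of [z |: X] above that of the hyperplane [X], and monotonicity bounds it
   by the full rank. *)
have rB : #|B| = matroid_rank BB.
  have := flX z zX; rewrite -cB rX => lt.
  by apply/eqP; rewrite eqn_leq -{1}(_ : mrank BB setT = matroid_rank BB) //
    {1}cB mrank_mono ?subsetT //=; lia.
have bB : B \in BB by apply: indep_card.
pose J := Y :\ z.
have cJ : #|J|.+1 = matroid_rank BB by rewrite -cY (cardsD1 z Y) zY.
have sJX : J \subset X.
  apply/subsetP => e; rewrite !inE => /andP [ez eY].
  by have := subsetP sY e eY; rewrite !inE (negPf ez).
(* A basis of the form [e |: J] lying in [z |: X] is [Y] or [X]. *)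
have no_ext e : e \notin J -> e \in z |: X -> e |: J \notin BB.
  move=> eJ eX; have [ez|ez] := eqVneq e z.
    by rewrite ez setD1K.
  have -> : e |: J = X; last by [].
  apply/eqP; rewrite eqEcard subUset sub1set sJX cardsU1 eJ add1n cJ cX leqnn.
  by move: eX; rewrite !inE (negPf ez) /= => ->.
have /existsP [B0 /andP [bB0 sJ0]] := indY J (properD1 zY).
have cB0 : #|B0 :\: J| = 1.
  by rewrite cardsD (setIidPr sJ0) (bases_card mBB bB0) -cJ; lia.
have /cards1P [e eB0] : #|B0 :\: J| == 1 by rewrite cB0.
have B0E : B0 = e |: J.
  by rewrite -(setID B0 J) (setIidPr sJ0) eB0 setUC.
have eJ : e \notin J by have := set11 e; rewrite -eB0 inE => /andP [].
have [eB|eB] := boolP (e \in B).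
  by have := no_ext e eJ (subsetP sB e eB); rewrite -B0E bB0.
(* Exchanging [e] against [B] extends [J] by an element of [z |: X]. *)
have eD : e \in B0 :\: B by rewrite inE eB B0E setU11.
have [y yD] := (proj2 mBB) _ _ bB0 bB e eD.
have -> : B0 :\ e = J by rewrite B0E setU1K.
move: yD; rewrite inE => /andP [yB0 yB].
rewrite (negPf (no_ext y _ _)) //; last exact: (subsetP sB).
by apply: contra yB0; apply: (subsetP sJ0).
Qed.

End SparsePaving.

(** * Reducing the distance when it is at least two *)

Section Reduce.
Context {E : finType}.
Variables (BB : {set {set E}}) (r : nat).
Implicit Types (X Y A B D G : {set E}) (L T : seq {set E}).

(* When neither [a1] nor [a2] can be exchanged directly for [b], the detour
   through some [w] in [D] works, since every basis on the way except
   [swap D w a1] is at distance one from one of the two given nonbases. *)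
Lemma exchange_two_out A D T a1 a2 b :
  scattered BB r -> A \in BB -> D \in BB -> all (fun X => X \in BB) T ->
  a1 \in A -> a1 \notin D -> a2 \in A -> a2 \notin D -> a1 != a2 ->
  b \in D -> b \notin A -> swap A a1 b \notin BB -> swap D b a2 \notin BB ->
  exists w D',
    linked BB [:: A, D & T] [:: swap (swap A a1 w) a2 b, D' & T].
Proof.
move=> H bA bD bT a1A a1D a2A a2D a12 bD' bA' nA nD.
have cAD : #|A| = #|D| by rewrite !(proj1 H).
(* Two unsuitable choices of [w] would give adjacent nonbases. *)
have [w wW gw] : exists2 w, w \in D :\: A :\ b & ~~ (swap D w a1 \notin BB).
  apply: exists_avoiding.
    move=> w w'; rewrite !inE => /and3P [wb wA wD] /and3P [wb' wA' wD'] nw nw'.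
    by apply/eqP; apply: contraNT nw' => ww'; adjacent H nw w.
  (* With fewer than two candidates, [A] and [D] differ in exactly two elements, and the two given
     nonbases are adjacent. *)
  rewrite leqNgt; apply/negP => lt2.
  have c1 : 2 <= #|A :\: D|.
    by apply/card_gt1P; exists a1, a2; rewrite !inE a1A a1D a2A a2D.
  rewrite (card_setDC cAD) (cardsD1 b) !inE bA' bD' in c1.
  have /cards1P [w ew] : #|D :\: A :\ b| == 1.
    by move: lt2 c1; clear; lia.
  have : w \in D :\: A :\ b by rewrite ew set11.
  rewrite !inE => /and3P [wb wA wD].
  have sD e : e \in D -> e != b -> e != w -> e \in A.
    move=> eD eb ew'; apply: contraNT ew' => eA.
    by rewrite -in_set1 -ew !inE eb eA eD.
  case/negP: nD; apply: (proj2 H _ _ w _ nA);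
    [swap_card H|swap_card H|set_solve|set_solve|].
  by apply/subsetP => e; move: (sD e); set_solve => // /(_ isT isT isT).
move: wW; rewrite !inE => /and3P [wb wA wD]; rewrite negbK in gw.
exists w, (swap (swap D w a1) b a2).
have g1 : swap A a1 w \in BB by adjacent H nA w.
apply: (@linked_trans _ _ _ [:: swap A a1 w, swap D w a1 & T]).
  exact: linked_swap.
apply: linked_swap => //; try by set_solve.
  by adjacent H nA w.
by adjacent H nD a1.
Qed.

(** The mirror image of the previous detour: two elements of [D] may enter, and the auxiliary
    element [z] comes from [A]. *)
Lemma exchange_two_in A D T a b1 b2 :
  scattered BB r -> A \in BB -> D \in BB -> all (fun X => X \in BB) T ->
  a \in A -> a \notin D -> b1 \in D -> b1 \notin A -> b2 \in D -> b2 \notin A ->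
  b1 != b2 -> swap A a b1 \notin BB -> swap D b2 a \notin BB ->
  exists z D',
    linked BB [:: A, D & T] [:: swap (swap A z b1) a b2, D' & T].
Proof.
move=> H bA bD bT aA aD b1D b1A b2D b2A b12 nA nD.
have cAD : #|A| = #|D| by rewrite !(proj1 H).
have [z zZ gz] : exists2 z, z \in A :\: D :\ a & ~~ (swap D b1 z \notin BB).
  apply: exists_avoiding.
    move=> z z'; rewrite !inE => /and3P [za zD zA] /and3P [za' zD' zA'] nz nz'.
    by apply/eqP; apply: contraNT nz' => zz'; adjacent H nz z'.
  rewrite leqNgt; apply/negP => lt2.
  have c1 : 2 <= #|D :\: A|.
    by apply/card_gt1P; exists b1, b2; rewrite !inE b1A b1D b2A b2D.
  rewrite -(card_setDC cAD) in c1.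
  have c2 : #|D :\: A| <= 2.
    by rewrite -(card_setDC cAD) (cardsD1 a) !inE aA aD; move: lt2; clear; lia.
  have eDA : [set b1; b2] = D :\: A.
    apply/eqP; rewrite eqEcard cards2 b12 c2 andbT.
    by apply/subsetP => e; rewrite !inE => /orP [] /eqP ->; rewrite ?b1A ?b2A.
  have sD e : e \in D -> e != b1 -> e != b2 -> e \in A.
    move=> eD e1 e2; apply: contraT => eA.
    have : e \in D :\: A by rewrite inE eA.
    by rewrite -eDA !inE (negPf e1) (negPf e2).
  case/negP: nD; apply: (proj2 H _ _ a _ nA);
    [swap_card H|swap_card H|set_solve|set_solve|].
  by apply/subsetP => e; move: (sD e); set_solve => // /(_ isT isT isT).
move: zZ; rewrite !inE => /and3P [za zD zA]; rewrite negbK in gz.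
exists z, (swap (swap D b1 z) b2 a).
have g1 : swap A z b1 \in BB by adjacent H nA a.
apply: (@linked_trans _ _ _ [:: swap A z b1, swap D b1 z & T]).
  exact: linked_swap.
apply: linked_swap => //; try by set_solve.
  by adjacent H nA b2.
by adjacent H nD z.
Qed.

Lemma diff_card_lt A A' B a :
  a \in A -> a \notin B -> A' :\: B \subset A :\: B :\ a ->
  #|A' :\: B| < #|A :\: B|.
Proof.
move=> aA aB s; have := subset_leq_card s.
by rewrite (cardsD1 a (A :\: B)) !inE aA aB.
Qed.

(** With two candidates on one side, at most one is blocked in [A] and at most one in [D]. If no
    direct exchange works, the blocked ones are different, which is the situation of the two
    detours. *)
Lemma reduce_distance A B D T :
  scattered BB r -> A \in BB -> B \in BB -> D \in BB ->
  all (fun X => X \in BB) T -> 2 <= #|A :\: B| ->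
  #|D :&: (A :\: B)| < #|D :&: (B :\: A)| ->
  exists A' T', linked BB [:: A, D & T] (A' :: T') /\ #|A' :\: B| < #|A :\: B|.
Proof.
move=> H bA bB bD bT d2 fg.
have direct a b : a \in A -> a \notin B -> a \notin D -> b \in B -> b \notin A ->
    b \in D -> swap A a b \in BB -> swap D b a \in BB ->
    exists A' T', linked BB [:: A, D & T] (A' :: T') /\ #|A' :\: B| < #|A :\: B|.
  move=> aA aB aD bB' bA' bD' g1 g2.
  exists (swap A a b), (swap D b a :: T); split; first exact: linked_swap.
  by apply: (diff_card_lt aA aB); apply/subsetP => e; set_solve.
have cAB : #|B :\: A| = #|A :\: B| by apply: card_setDC; rewrite !(proj1 H).
(* The two cardinalities add up to more than [#|A :\: B|], hence to at least three. *)
have pq : 0 < #|A :\: B :\: D| /\ 0 < #|D :&: (B :\: A)| /\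
    (1 < #|A :\: B :\: D| \/ 1 < #|D :&: (B :\: A)|).
  have := cardsID D (A :\: B); have := subset_leq_card (subsetIr D (B :\: A)).
  rewrite [_ :&: D]setIC cAB; move: fg d2; clear; lia.
case: pq => /card_gt0P [a aP] [/card_gt0P [b bQ] pq].
move: aP bQ; rewrite !inE => /and3P [aD aB aA] /and3P [bD' bA' bB'].
case: pq => /card_gt1P [x [y []]]; rewrite !inE.
- move=> /and3P [xD xB xA] /and3P [yD yB yA] xy.
  have [gx|nx] := boolP (swap A x b \in BB).
    have [gx'|nx'] := boolP (swap D b x \in BB); first exact: (direct x b).
    have gy' : swap D b y \in BB by adjacent H nx' y.
    have [gy|ny] := boolP (swap A y b \in BB); first exact: (direct y b).
    have yx : y != x by rewrite eq_sym.
    have [w [D' l]] := exchange_two_out H bA bD bT yA yD xA xD yx bD' bA' ny nx'.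
    exists (swap (swap A y w) x b), (D' :: T); split=> //.
    (* The detour removes both [x] and [y] from the difference, which pays for a possible new
       element [w]. *)
    apply: (@leq_ltn_trans #|w |: (A :\: B :\ x :\ y)|).
      by apply/subset_leq_card/subsetP => e; set_solve.
    rewrite (cardsD1 x (A :\: B)) (cardsD1 y (A :\: B :\ x)) !inE xA xB yA yB yx.
    by rewrite cardsU1; case: (w \notin _); clear; lia.
  have gy : swap A y b \in BB by adjacent H nx x.
  have [gy'|ny'] := boolP (swap D b y \in BB); first exact: (direct y b).
  have [w [D' l]] := exchange_two_out H bA bD bT xA xD yA yD xy bD' bA' nx ny'.
  exists (swap (swap A x w) y b), (D' :: T); split=> //.
  have yx : y != x by rewrite eq_sym.
  apply: (@leq_ltn_trans #|w |: (A :\: B :\ x :\ y)|).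
    by apply/subset_leq_card/subsetP => e; set_solve.
  rewrite (cardsD1 x (A :\: B)) (cardsD1 y (A :\: B :\ x)) !inE xA xB yA yB yx.
  by rewrite cardsU1; case: (w \notin _); clear; lia.
- move=> /and3P [xD xA xB] /and3P [yD yA yB] xy.
  have yx : y != x by rewrite eq_sym.
  have [gx|nx] := boolP (swap A a x \in BB).
    have [gx'|nx'] := boolP (swap D x a \in BB); first exact: (direct a x).
    have gy' : swap D y a \in BB by adjacent H nx' x.
    have [gy|ny] := boolP (swap A a y \in BB); first exact: (direct a y).
    have [z [D' l]] := exchange_two_in H bA bD bT aA aD yD yA xD xA yx ny nx'.
    exists (swap (swap A z y) a x), (D' :: T); split=> //.
    by apply: (diff_card_lt aA aB); apply/subsetP => e; set_solve.
  have gy : swap A a y \in BB by adjacent H nx y.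
  have [gy'|ny'] := boolP (swap D y a \in BB); first exact: (direct a y).
  have [z [D' l]] := exchange_two_in H bA bD bT aA aD xD xA yD yA xy nx ny'.
  exists (swap (swap A z x) a y), (D' :: T); split=> //.
  by apply: (diff_card_lt aA aB); apply/subsetP => e; set_solve.
Qed.

(** * Unblocking the last exchange at distance one *)

Lemma scattered_card_diff1 X Y :
  scattered BB r -> #|X| = r -> X \notin BB -> #|Y| = r -> #|Y :\: X| = 1 ->
  Y \in BB.
Proof.
move=> H cX nX cY /eqP/cards1P [z ez].
have : z \in Y :\: X by rewrite ez set11.
rewrite inE => /andP [zX zY]; apply: (proj2 H X Y z) => //.
by rewrite setUC -subDset ez subxx.
Qed.

(** An exchange of [f] and [g] fails only at nonbases, and adjacent ones cannot coexist. Three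
    candidates on one side therefore suffice; smaller cases use the nearness of [G] to [N] or to
    [D]. *)
Lemma exchange_near_nonbasis D G a b :
  scattered BB r -> D \in BB -> G \in BB ->
  b \in D -> a \notin D -> swap D b a \notin BB ->
  2 <= #|G :\: swap D b a| ->
  [/\ a \notin G, b \in G & swap G b a \in BB] \/
  exists f g, [/\ f \in D :\: G :\ b, g \in G :\: D :\ a,
    swap D f g \in BB & swap G g f \in BB].
Proof.
move=> H bD bG bD' aD nN; set N := swap D b a in nN * => t2.
set P := D :\: G :\ b; set Q := G :\: D :\ a.
have cN : #|N| = r by swap_card H.
have cNG : #|N :\: G| = #|G :\: N| by apply: card_setDC; rewrite cN (proj1 H).
have cP : #|G :\: N| = (a \notin G) + #|P|.
  rewrite -cNG (cardsD1 a) (_ : N :\: G :\ a = P).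
    by congr (_ + _); rewrite /N; set_solve.
  by apply/setP => e; rewrite /N /P; set_solve.
have cQ : #|G :\: N| = (b \in G) + #|Q|.
  rewrite (cardsD1 b) (_ : G :\: N :\ b = Q).
    by congr (_ + _); rewrite /N; set_solve.
  by apply/setP => e; rewrite /N /Q; set_solve.
have inP f : f \in P -> [/\ f != b, f \notin G & f \in D].
  by rewrite !inE => /and3P.
have inQ g : g \in Q -> [/\ g != a, g \notin D & g \in G].
  by rewrite !inE => /and3P.
have uD1 g : g \in Q -> {in P &, forall f f',
    swap D f g \notin BB -> swap D f' g \notin BB -> f = f'}.
  move=> /inQ [ga gD gG] f f' /inP [fb fG fD] /inP [fb' fG' fD'] n n'.
  by apply/eqP; apply: contraNT n' => ff; adjacent H n f.
have uD2 f : f \in P -> {in Q &, forall g g',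
    swap D f g \notin BB -> swap D f g' \notin BB -> g = g'}.
  move=> /inP [fb fG fD] g g' /inQ [ga gD gG] /inQ [ga' gD' gG'] n n'.
  by apply/eqP; apply: contraNT n' => ff; adjacent H n g'.
have uG1 g : g \in Q -> {in P &, forall f f',
    swap G g f \notin BB -> swap G g f' \notin BB -> f = f'}.
  move=> /inQ [ga gD gG] f f' /inP [fb fG fD] /inP [fb' fG' fD'] n n'.
  by apply/eqP; apply: contraNT n' => ff; adjacent H n f'.
have uG2 f : f \in P -> {in Q &, forall g g',
    swap G g f \notin BB -> swap G g' f \notin BB -> g = g'}.
  move=> /inP [fb fG fD] g g' /inQ [ga gD gG] /inQ [ga' gD' gG'] n n'.
  by apply/eqP; apply: contraNT n' => ff; adjacent H n g.
have [P3|P3] := leqP 3 #|P|.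
  right; have /card_gt0P [g gQ] : 0 < #|Q|.
    by move: t2 cP cQ P3; case: (a \in G); case: (b \in G); clear; lia.
  have [f [fP g1 g2]] := exists_avoiding2 (uD1 g gQ) (uG1 g gQ) P3.
  by exists f, g; rewrite !negbK in g1 g2.
have [Q3|Q3] := leqP 3 #|Q|.
  right; have /card_gt0P [f fP] : 0 < #|P|.
    by move: t2 cP cQ Q3; case: (a \in G); case: (b \in G); clear; lia.
  have [g [gQ g1 g2]] := exists_avoiding2 (uD2 f fP) (uG2 f fP) Q3.
  by exists f, g; rewrite !negbK in g1 g2.
have /card_gt0P [f0 fP0] : 0 < #|P|.
  by move: t2 cP; case: (a \in G); clear; lia.
have /card_gt0P [g0 gQ0] : 0 < #|Q|.
  by move: t2 cQ; case: (b \in G); clear; lia.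
(* At distance two from [N], any exchange moving [G] towards [N] yields a neighbour of [N], hence a
   basis; only the condition on [D] remains. *)
have [t_eq2|t_gt2] : #|G :\: N| = 2 \/ 3 <= #|G :\: N| by move: t2; clear; lia.
  have goodG f g : f \in N -> f \notin G -> g \in G -> g \notin N ->
      swap G g f \in BB.
    move=> fN fG gG gN; apply: (scattered_card_diff1 H cN nN).
      by rewrite card_swap // (proj1 H).
    rewrite (_ : _ :\: _ = G :\: N :\ g).
      by move: t_eq2; rewrite (cardsD1 g) in_setD gG gN => -[].
    by apply/setP => e; rewrite /N in fN gN *; move: fN gN; set_solve.
  have goodPQ f g : f \in P -> g \in Q -> swap G g f \in BB.
    move=> /inP [fb fG fD] /inQ [ga gD gG].
    by apply: goodG => //; rewrite /N; set_solve.
  have [P2|P1] := leqP 2 #|P|.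
    have [f fP] := exists_avoiding (uD1 g0 gQ0) P2; rewrite negbK => g1.
    by right; exists f, g0; split=> //; apply: goodPQ.
  have [Q2|Q1] := leqP 2 #|Q|.
    have [g gQ] := exists_avoiding (uD2 f0 fP0) Q2; rewrite negbK => g1.
    by right; exists f0, g; split=> //; apply: goodPQ.
  left; have [aG bG'] : a \notin G /\ b \in G.
    move: t_eq2 cP cQ P1 Q1.
    by case: (a \in G); case: (b \in G) => //; clear; lia.
  by split=> //; apply: goodG => //; rewrite /N; set_solve.
(* Both [P] and [Q] now have two elements, so [G - D] is exactly [Q]. If [D - f0 + g] is a nonbasis,
   its neighbour [G - g' + f0] is a basis for the other element [g'] of [Q]. *)
have [aG Q2] : a \notin G /\ 2 <= #|Q|.
  move: t_gt2 cP cQ P3 Q3.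
  by case: (a \in G); case: (b \in G) => //; clear; lia.
right; case/card_gt1P: (Q2) => g1 [g2 [gQ1 gQ2 g12]].
have [fb fG fD] := inP _ fP0; have [ga1 gD1 gG1] := inQ _ gQ1.
have [ga2 gD2 gG2] := inQ _ gQ2.
have eQ : [set g1; g2] = Q.
  apply/eqP; rewrite eqEcard cards2 g12 -ltnS Q3 andbT.
  by apply/subsetP => e; rewrite in_set2 => /orP [] /eqP ->.
have cross g g' : g != g' -> [set g; g'] = Q -> g \in G -> g' \in G ->
    g \notin D -> g' \notin D ->
    swap D f0 g \in BB \/ swap G g' f0 \in BB.
  move=> gg' eQ' gG gG' gD gD'.
  have [|n] := boolP (swap D f0 g \in BB); [by left|right].
  apply: (scattered_card_diff1 H _ n); [swap_card H|swap_card H|].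
  rewrite (_ : _ :\: _ = [set f0]) ?cards1 //; apply/setP => e.
  have : (e \in G :\: D) = (e \in [set g; g']).
    by rewrite eQ' /Q; set_solve.
  by set_solve.
have [d1|d1] := boolP (swap D f0 g1 \in BB);
have [d2|d2] := boolP (swap D f0 g2 \in BB).
- have [e1|e1] := boolP (swap G g1 f0 \in BB); first by exists f0, g1.
  have [e2|e2] := boolP (swap G g2 f0 \in BB); first by exists f0, g2.
  by case/eqP: g12; apply: (uG2 f0).
- have g21 : g2 != g1 by rewrite eq_sym.
  have e21 : [set g2; g1] = Q by rewrite setUC.
  have [|e1] := cross g2 g1 g21 e21 gG2 gG1 gD2 gD1; first by rewrite (negPf d2).
  by exists f0, g1.
- have [|e2] := cross g1 g2 g12 eQ gG1 gG2 gD1 gD2.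
    by rewrite (negPf d1).
  by exists f0, g2.
- by case/eqP: g12; apply: (uD2 f0).
Qed.

(** Either [G] takes the place of [D] as partner of [A], or an exchange between [D] and [G] first
    turns the blocking nonbasis into one of its neighbours. *)
Lemma last_exchange A D G T a b :
  scattered BB r -> A \in BB -> D \in BB -> G \in BB ->
  all (fun X => X \in BB) T -> a \in A -> a \notin D -> b \in D -> b \notin A ->
  swap A a b \in BB -> swap D b a \notin BB -> 2 <= #|G :\: swap D b a| ->
  exists T', linked BB [:: A, D, G & T] (swap A a b :: T').
Proof.
move=> H bA bD bG bT aA aD bD' bA' bAab nN far.
have [[aG bG' bGba]|[f [g [fP gQ bD1 bG1]]]] :=
  exchange_near_nonbasis H bD bG bD' aD nN far; clear far.
- exists (swap G b a :: D :: T).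
  apply: (@linked_trans _ _ _ [:: A, G, D & T]).
    by apply: linked_perm; [rewrite /= bA bD bG|apply/permP => p /=; clear; lia].
  by apply: linked_swap; rewrite //= bD.
move: fP gQ; rewrite !inE => /and3P [fb fG fD] /and3P [ga gD gG].
exists (swap (swap D f g) b a :: swap G g f :: T).
apply: (@linked_trans _ _ _ [:: A, swap D f g, swap G g f & T]).
  by apply: linked_cons => //; apply: linked_swap.
apply: linked_swap; rewrite //= ?bG1 //; try by set_solve.
by adjacent H nN g.
Qed.

(** * Descent and the induction on the number of bases *)

Lemma sum_le_size (L : seq {set E}) (F : {set E} -> nat) :
  {in L, forall X, F X <= 1} -> \sum_(X <- L) F X <= size L.
Proof.
move=> h; rewrite -sum1_size !big_seq; exact: leq_sum.
Qed.

Lemma descend A B D T T' :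
  scattered BB r -> all (fun X => X \in BB) (A :: T) ->
  all (fun X => X \in BB) (B :: T') -> size T = size T' ->
  (forall e, count (fun X : {set E} => e \in X) (A :: T)
           = count (fun X : {set E} => e \in X) (B :: T')) ->
  D \in T -> #|D :&: (A :\: B)| < #|D :&: (B :\: A)| ->
  exists A' T1, linked BB (A :: T) (A' :: T1) /\ #|A' :\: B| < #|A :\: B|.
Proof.
move=> H /andP [bA bT] /andP [bB bT'] sz cnt DT fg.
have pT := perm_to_rem DT.
have bT2 : all (fun X => X \in BB) (D :: rem D T) by rewrite -(perm_all _ pT).
have [bD bT0] : D \in BB /\ all (fun X => X \in BB) (rem D T) by apply/andP.
have lT : linked BB (A :: T) [:: A, D & rem D T].
  by apply: linked_perm; rewrite /= ?bA // perm_cons.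
have cAB : #|B :\: A| = #|A :\: B| by apply: card_setDC; rewrite !(proj1 H).
suff [A' [T1 [l d]]] : exists A' T1,
    linked BB [:: A, D & rem D T] (A' :: T1) /\ #|A' :\: B| < #|A :\: B|.
  by exists A', T1; split=> //; exact: linked_trans lT l.
have [d2|d1] := leqP 2 #|A :\: B|; first exact: reduce_distance.
have d_eq1 : #|A :\: B| = 1.
  have := subset_leq_card (subsetIr D (B :\: A)).
  by move: fg d1; rewrite cAB; clear; lia.
have /cards1P [a ea] : #|A :\: B| == 1 by rewrite d_eq1.
have /cards1P [b eb] : #|B :\: A| == 1 by rewrite cAB d_eq1.
have : a \in A :\: B by rewrite ea set11.
have : b \in B :\: A by rewrite eb set11.
rewrite !inE => /andP [bA' bB'] /andP [aB aA].
have eB : B = swap A a b.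
  apply/setP => e; have /setP/(_ e) := ea; have /setP/(_ e) := eb.
  by set_solve.
have [aD bD'] : a \notin D /\ b \in D.
  move: fg; rewrite ea eb.
  have h x : #|D :&: [set x]| = (x \in D).
    have [xD|xD] := boolP (x \in D).
      by rewrite (setIidPr _) ?cards1 // sub1set.
    by apply/eqP; rewrite cards_eq0 setI_eq0 disjoint_sym disjoints1.
  by rewrite !h; case: (a \in D); case: (b \in D).
have d0 T1 : linked BB [:: A, D & rem D T] (swap A a b :: T1) ->
    exists A' T1, linked BB [:: A, D & rem D T] (A' :: T1)
      /\ #|A' :\: B| < #|A :\: B|.
  move=> l; exists (swap A a b), T1; split=> //.
  by rewrite -eB setDv cards0 d_eq1.
have bAab : swap A a b \in BB by rewrite -eB.
have [bN|nN] := boolP (swap D b a \in BB).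
  by apply: (d0 (swap D b a :: rem D T)); apply: linked_swap.
have [/hasP [G GT far]|near] :=
    boolP (has (fun G : {set E} => 2 <= #|G :\: swap D b a|) (rem D T)).
  have pT0 := perm_to_rem GT.
  have bG : G \in BB := allP bT0 _ GT.
  have bT1 : all (fun X => X \in BB) (rem G (rem D T)).
    by move: bT0; rewrite (perm_all _ pT0) => /andP [].
  have [T1 l] := last_exchange H bA bD bG bT1 aA aD bD' bA' bAab nN far.
  apply: (d0 T1); apply: linked_trans l; apply: linked_perm.
    by rewrite /= bA bD.
  by rewrite !perm_cons.
(* Otherwise the tail of [A] is too close to the nonbasis [N]: counting with
   multiplicity the elements outside [N] would make [N] a member of [T']. *)
set N := swap D b a in nN near.
have cN : #|N| = r by swap_card H.
have sums : \sum_(X <- A :: T) #|X :\: N| = \sum_(X <- B :: T') #|X :\: N|.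
  under eq_bigr do rewrite setDE.
  under [RHS]eq_bigr do rewrite setDE.
  by rewrite !sum_card_setI; apply: eq_bigr => e _; apply: cnt.
have szT : size T = (size (rem D T)).+1 by rewrite (perm_size pT).
have eDN : #|D :\: N| = 1.
  rewrite (_ : _ :\: _ = [set b]) ?cards1 //.
  by apply/setP => e; rewrite /N; set_solve.
have eABN : #|B :\: N| = #|A :\: N|.+1.
  rewrite (cardsD1 b) (_ : B :\: N :\ b = A :\: N).
    by rewrite -add1n; congr (_ + _); rewrite /N; set_solve.
  by apply/setP => e; rewrite eB /N; set_solve.
have leT0 : \sum_(X <- rem D T) #|X :\: N| <= size (rem D T).
  by apply: sum_le_size => X XT; have := hasPn near X XT; rewrite -ltnNge ltnS.
have geT' : size T' <= \sum_(X <- T') #|X :\: N|.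
  rewrite -sum1_size big_seq [X in _ <= X]big_seq; apply: leq_sum => X XT'.
  have bX := allP bT' _ XT'.
  rewrite card_gt0 setD_eq0; apply: contra nN => sX.
  by rewrite -(_ : X = N) //; apply/eqP; rewrite eqEcard sX cN (proj1 H) ?leqnn.
have sumT : \sum_(X <- T) #|X :\: N| = 1 + \sum_(X <- rem D T) #|X :\: N|.
  by rewrite (perm_big _ pT) big_cons eDN.
(* The first list has at most [#|A :\: N| + size T] elements outside [N], the second at least
   [#|A :\: N| + 1 + size T']. *)
move: sums; rewrite !big_cons sumT eABN.
by move: leT0 geT' szT sz; clear; lia.
Qed.

(** Outer induction on the length removes equal heads; inner induction on [#|A :\: B|] makes the
    heads equal, changing whichever list has a favourable member [D]. *)
Lemma same_counts_linked L L' :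
  scattered BB r -> all (fun X => X \in BB) L -> all (fun X => X \in BB) L' ->
  size L = size L' ->
  (forall e, count (fun X : {set E} => e \in X) L
           = count (fun X : {set E} => e \in X) L') ->
  linked BB L L'.
Proof.
move=> H; elim: {L}(size L) {-2}L L' (erefl (size L)) => [|n IH] L L'.
  by move=> /size0nil -> _ _ /esym/size0nil -> _; apply: rst_refl.
case: L => // A T [sT]; case: L' => // B T'.
have [d] := ubnP #|A :\: B|; elim: d A T B T' sT => // d IHd A T B T' sT lt_d.
move=> bL bL' [sTT'] cnt.
have [bA bT] := andP bL; have [bB bT'] := andP bL'.
have [eAB|nAB] := eqVneq A B.
  rewrite -eAB in bL' cnt *; apply: linked_cons => //; apply: IH => // e.
  exact: addnI (cnt e).
(* With [S] the multiplicity function of [L1], being a vertex is the invariant carried along the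
   chain. *)
have inv A' T1 L1 : linked BB L1 (A' :: T1) -> all (fun X => X \in BB) L1 ->
    [/\ size (A' :: T1) = size L1, all (fun X => X \in BB) (A' :: T1) &
     forall e, count (fun X : {set E} => e \in X) (A' :: T1)
             = count (fun X : {set E} => e \in X) L1].
  move=> l bL1; pose S := [ffun e => count (fun X : {set E} => e \in X) L1].
  have [[v _] _] := linked_GM (size L1) S l.
  have [|s1 [b1 c1]] := v; first by split=> //; split=> // e; rewrite ffunE.
  by split=> // e; rewrite c1 ffunE.
have cAB : #|B :\: A| = #|A :\: B| by apply: card_setDC; rewrite !(proj1 H).
have d_gt0 : 0 < #|A :\: B|.
  rewrite card_gt0 setD_eq0; apply: contra nAB => sAB.
  by rewrite eqEcard sAB !(proj1 H) ?leqnn.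
have [/hasP [D DT fg]|noT] :=
    boolP (has (fun D : {set E} => #|D :&: (A :\: B)| < #|D :&: (B :\: A)|) T).
  have [A' [T1 [l lt]]] := descend H bL bL' sTT' cnt DT fg.
  have [[s1] b1 c1] := inv _ _ _ l bL.
  apply: linked_trans l _; apply: IHd => //.
  - by rewrite s1.
  - exact: leq_trans lt lt_d.
  - by rewrite /= s1 sTT'.
  - by move=> e; rewrite c1.
have [/hasP [D DT fg]|noT'] :=
    boolP (has (fun D : {set E} => #|D :&: (B :\: A)| < #|D :&: (A :\: B)|) T').
  have cnt' e := esym (cnt e).
  have [B' [T1 [l lt]]] := descend H bL' bL (esym sTT') cnt' DT fg.
  have [[s1] b1 c1] := inv _ _ _ l bL'.
  apply: linked_trans (linked_sym l); apply: IHd => //.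
  - rewrite card_setDC; last first.
      by have [bB' _] := andP b1; rewrite !(proj1 H).
    by rewrite cAB in lt; exact: leq_trans lt lt_d.
  - by rewrite /= s1 sTT'.
  - by move=> e; rewrite c1.
(* Without a favourable member, the tails can only reinforce the imbalance of the heads on [A :\: B]
   and [B :\: A], contradicting equal multiplicities. *)
have sums (Z : {set E}) :
    \sum_(X <- A :: T) #|X :&: Z| = \sum_(X <- B :: T') #|X :&: Z|.
  by rewrite !sum_card_setI; apply: eq_bigr => e _; apply: cnt.
have := sums (A :\: B); have := sums (B :\: A); rewrite !big_cons.
have eI (X Y : {set E}) : X :&: (X :\: Y) = X :\: Y.
  by apply/setIidPr/subsetDl.
have e0 (X Y : {set E}) : X :&: (Y :\: X) = set0.
  by apply/setP => e; rewrite !inE; case: (e \in X); rewrite ?andbF.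
rewrite !eI !e0 cards0 cAB.
have leT : \sum_(X <- T) #|X :&: (B :\: A)| <= \sum_(X <- T) #|X :&: (A :\: B)|.
  rewrite big_seq [X in _ <= X]big_seq; apply: leq_sum => X XT.
  by rewrite leqNgt; apply: (hasPn noT).
have leT' : \sum_(X <- T') #|X :&: (A :\: B)| <= \sum_(X <- T') #|X :&: (B :\: A)|.
  rewrite big_seq [X in _ <= X]big_seq; apply: leq_sum => X XT.
  by rewrite leqNgt; apply: (hasPn noT').
by move: leT leT' d_gt0; clear; lia.
Qed.

End Reduce.

(** * Connectedness of the exchange graph *)

Theorem theorem2p4 (E : finType) (BB : {set {set E}}) (r k : nat)
  (S : {ffun E -> nat}) :
  is_matroid_bases BB ->
  matroid_rank BB = r ->
  sparse_paving BB ->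
  2 <= k ->
  \sum_(e : E) S e = k * r ->
  GM_connected BB k S.
Proof.
move=> mBB _ sp _ _ L L' vL vL'.
have [sL [bL cL]] := vL; have [sL' [bL' cL']] := vL'.
have l : linked BB L L'.
  apply: (same_counts_linked (sparse_paving_scattered mBB sp)) => //.
    by rewrite sL sL'.
  by move=> e; rewrite cL cL'.
by have [_] := linked_GM k S l; apply.
Qed.
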